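(* Let $\kappa$ be a cardinal and assume $\mathrm{MA}_\kappa$. Then every branchwise-real tree order $X$ with at most $\kappa$ many branching nodes is continuously gradable.
   Context: A tree order is a partial order with a minimum element such that for every $x$ the set $\{y\mid y\le x\}$ is linearly ordered; a branch is a maximal linearly ordered subset. A branchwise-real tree order is a tree order in which every branch is order-isomorphic to a real interval and any two elements have a greatest lower bound. It is continuously gradable if there is a strictly monotonic $\ell\colon X\to\mathbb{R}$ whose restriction to each $[x,y]=\{z\mid x\le z\le y\}$ ($x<y$) is an order-isomorphism onto $[\ell(x),\ell(y)]$. For $x\in X$, the $x$-connected components are the equivalence classes of $\{y\mid y>x\}$ under $y\sim_x z$ iff there is $w>x$ with $w\le y,z$; $x$ is branching if there is more than one class. A forcing poset is a partial order with a maximum element; an antichain in it is a set of pairwise incompatible elements (no common lower bound); it is ccc if all antichains are countable; $D$ is dense if every $p$ has some $q\le p$ in $D$; a filter is a non-empty upwards-closed set $F$ such that any two elements of $F$ have a common lower bound in $F$. $\mathrm{MA}_\kappa$ is the statement that for every ccc forcing poset $\mathbb{P}$ and every family of $\kappa$ many dense subsets of $\mathbb{P}$ there is a filter meeting each of them. *)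

(* Defs.v *)
From mathcomp Require Import all_boot all_order all_algebra.
From mathcomp Require Import boolp classical_sets functions cardinality.
From mathcomp Require Import set_interval reals.

Set Implicit Arguments.
Unset Strict Implicit.
Unset Printing Implicit Defensive.

Import Order.TTheory.

Local Open Scope classical_set_scope.
Local Open Scope card_scope.
Local Open Scope order_scope.

(* Only the values of [f] on [A] matter. *)
Definition order_iso_on (d d' : Order.disp_t) (T : porderType d)
    (T' : porderType d') (A : set T) (B : set T') (f : T -> T') : Prop :=
  set_bij A B f /\ {in A &, {mono f : x y / x <= y}}.

Definition linearly_ordered (d : Order.disp_t) (T : porderType d)
    (A : set T) : Prop :=
  total_on A (fun x y => x <= y).

Definition branch (d : Order.disp_t) (T : porderType d) (B : set T) : Prop :=
  linearly_ordered B /\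
  forall C : set T, linearly_ordered C -> B `<=` C -> C = B.

(* The minimum element is the [\bot] of [bPOrderType]. *)
Definition tree_order (d : Order.disp_t) (X : bPOrderType d) : Prop :=
  forall x : X, linearly_ordered [set y : X | y <= x].

(* Degenerate intervals [`[a, a]] are allowed (a one-point tree order has a
   one-point branch). *)
Definition branchwise_real (R : realType) (d : Order.disp_t)
    (X : bPOrderType d) : Prop :=
  [/\ tree_order X,
      (forall B : set X, branch B ->
         exists (i : interval R) (f : X -> R), order_iso_on B [set` i] f)
    & (forall x y : X, infimums [set x; y] !=set0)].

Definition continuously_gradable (R : realType) (d : Order.disp_t)
    (X : bPOrderType d) : Prop :=
  exists l : X -> R,
    {homo l : x y / x < y} /\
    forall x y : X, x < y ->
      order_iso_on `[x, y]%classic `[l x, l y]%classic l.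

Definition above_rel (d : Order.disp_t) (X : porderType d) (x y z : X) : Prop :=
  exists w : X, [/\ x < w, w <= y & w <= z].

Definition connected_components (d : Order.disp_t) (X : porderType d) (x : X) :
    set (set X) :=
  [set C | exists2 y : X, x < y & C = [set z | x < z /\ above_rel x y z]].

Definition branching (d : Order.disp_t) (X : porderType d) (x : X) : Prop :=
  exists C D : set X,
    [/\ connected_components x C, connected_components x D & C <> D].

(* A forcing poset is a [tPOrderType]: its maximum element is [\top]. *)

Definition compatible (d : Order.disp_t) (P : porderType d) (p q : P) : Prop :=
  exists r : P, r <= p /\ r <= q.

Definition forcing_antichain (d : Order.disp_t) (P : porderType d)
    (A : set P) : Prop :=
  forall p q : P, A p -> A q -> p <> q -> ~ compatible p q.

Definition ccc (d : Order.disp_t) (P : porderType d) : Prop :=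
  forall A : set P, forcing_antichain A -> countable A.

Definition forcing_dense (d : Order.disp_t) (P : porderType d)
    (D : set P) : Prop :=
  forall p : P, exists2 q : P, D q & q <= p.

Definition forcing_filter (d : Order.disp_t) (P : porderType d)
    (F : set P) : Prop :=
  [/\ F !=set0,
      (forall p q : P, F p -> p <= q -> F q)
    & (forall p q : P, F p -> F q -> exists r : P, [/\ F r, r <= p & r <= q])].

(* The cardinal is presented as the cardinality of an arbitrary type [K], and
   a family of that many dense sets as a [K]-indexed family. *)
Definition martin_axiom (K : Type) : Prop :=
  forall (d : Order.disp_t) (P : tPOrderType d), ccc P ->
  forall D : K -> set P, (forall k, forcing_dense (D k)) ->
  exists F : set P, forcing_filter F /\ forall k, F `&` D k !=set0.

(* Main.v *)
Require Import Defs.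
From HB Require Import structures.
From mathcomp Require Import all_boot all_order all_algebra.
From mathcomp Require Import boolp classical_sets functions cardinality.
From mathcomp Require Import set_interval reals filter wochoice.
From mathcomp Require Import lra.

(* Well-order [X] and let [s x] be the point where [[\bot, x]] leaves the union
   of the segments [[\bot, y]] with [y] before [x].  The bump of [x] is a
   continuous monotone function to [[0, 1]] that is positive exactly on the
   [s x]-connected component of [x] (its cone) and strictly increasing on
   [[s x, x]].  Bumps separate the points of every segment, only countably many
   are positive at a given point, and any two cones are nested or disjoint.
   If the bumps are coloured by natural numbers so that overlapping bumps get
   different colours, then the bumps of each colour glue to one continuous
   monotone function [psi n], and [\sum_n psi n / 2 ^ (n + 1)] is the required
   grading.

   Bumps whose cone contains a branching node number at most [kappa], and they
   are coloured by a generic filter for the poset of finite approximations to a colouring;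
   its ccc rests on the absence of uncountable chains of cones.  A cone without
   branching nodes is linear, so the remaining bumps fall into countable classes
   of mutually overlapping ones, and each class is coloured injectively. *)

Set Implicit Arguments.
Unset Strict Implicit.
Unset Printing Implicit Defensive.

Import Order.TTheory GRing.Theory Num.Theory.

Local Open Scope ring_scope.
Local Open Scope order_scope.
Local Open Scope classical_set_scope.
Local Open Scope card_scope.

(** * Specializing a tree-like relation under Martin's axiom *)

Lemma countable_sub T (A B : set T) : A `<=` B -> countable B -> countable A.
Proof. by move=> /subset_card_le; exact: sub_countable. Qed.

Lemma countableU T (A B : set T) :
  countable A -> countable B -> countable (A `|` B).
Proof.
move=> cA cB; rewrite -bigcup2E; apply: bigcup_countable => // i _.
by rewrite /bigcup2; case: ifP => // _; case: ifP.
Qed.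

(** If the first set is not in [U], its complement is, and intersecting [W] with it leaves a shorter
    cover. *)
Lemma ultra_bigcup_seq (I : Type) (E : eqType) (U : set_system I)
    (V : E -> set I) (s : seq E) (W : set I) :
  UltraFilter U -> U W -> (forall i, W i -> exists2 e, e \in s & V e i) ->
  exists2 e, e \in s & U (V e).
Proof.
move=> UU; elim: s W => [|e s IH] W UW Ws.
  by have [i /Ws[]] := @filter_ex _ U _ _ UW.
have [Ve|nVe] := in_ultra_setVsetC (V e) UU; first by exists e; rewrite ?mem_head.
have [|i [/Ws[e' + Vi] nVi]|e' e's Ve'] := IH (W `&` ~` V e).
- exact: filterI.
- by rewrite inE => /orP[/eqP ee|]; [rewrite ee in Vi | exists e'].
- by exists e'; rewrite // inE e's orbT.
Qed.

(** As [A] is uncountable, the sets containing all but countably many points of [A] form a proper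
    filter, which an ultrafilter refines. *)
Lemma ultra_cocountable (I : Type) (A : set I) : ~ countable A ->
  exists U : set_system I, [/\ UltraFilter U, U A &
    forall V : set I, countable V -> U (~` V)].
Proof.
move=> nA; pose F : set_system I := [set V | countable (A `\` V)].
have FF : ProperFilter F.
  apply: Build_ProperFilter_ex.
    move=> V FV; apply/not_existsP => nV; apply: nA.
    by apply: countable_sub FV => i Ai; split => //; exact: nV.
  split; rewrite /F /=.
  - by rewrite setDT; exact: countable0.
  - move=> V W cV cW; apply: countable_sub (countableU cV cW) => i [Ai nVW].
    have [Vi|] := pselect (V i); last by left.
    by right; split => // Wi; apply: nVW.
  - by move=> V W VW; apply: countable_sub => i [Ai nW]; split => // /VW.
have [U [UU FU]] := ultraFilterLemma FF; exists U; split => //.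
- by apply: FU; rewrite /F /= setDv; exact: countable0.
- by move=> V cV; apply: FU; apply: countable_sub cV => i [_ /contrapT].
Qed.

Section FiniteConditions.
Variables (E : eqType) (r : E -> E -> Prop) (D : set E).
Hypothesis r_tree : forall x y z, D x -> D y -> D z ->
  r x z -> r y z -> x = y \/ r x y \/ r y x.
Hypothesis r_chain : forall C : set E, C `<=` D ->
  (forall x y, C x -> C y -> x = y \/ r x y \/ r y x) -> countable C.

(* By induction on the size bound, some [e] common to uncountably many [p i] can
   be removed, so every [e] may be assumed to lie in countably many [p i].  As
   [r]-predecessors are countable, an ultrafilter of co-countable sets then picks
   for each [i] some [x \in p i] and an index [b] with [r x (nth b (p j))] for
   almost all [j]; the [x] sharing the same [b] form an [r]-chain. *)
Lemma countable_conflict (I : Type) k (p : I -> seq E) (A : set I) :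
  (forall i, A i -> (size (p i) <= k)%N) ->
  (forall i x, A i -> x \in p i -> D x) ->
  (forall i x y, A i -> x \in p i -> y \in p i -> ~ r x y) ->
  (forall i j, A i -> A j -> i <> j ->
    exists x y, [/\ x \in p i, y \in p j & r x y \/ r y x]) ->
  countable A.
Proof.
elim: k p A => [|k IH] p A Ak AD Ar Aconf.
  have [[i Ai]|/set0P/negP] := pselect (A !=set0); last first.
    by move/negPn/eqP->; exact: countable0.
  apply: countable_sub (countable1 i) => j Aj; apply: contrapT => ji.
  have [x [y [+ _ _]]] := Aconf _ _ Aj Ai ji.
  by have := Ak _ Aj; rewrite leqn0 size_eq0 => /eqP ->.
have fibre e : countable [set i | A i /\ e \in p i].
  apply: (IH (fun i => rem e (p i))).
  - by move=> i [Ai ei]; rewrite size_rem //; have := Ak _ Ai; case: (size _).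
  - by move=> i x [Ai _] /mem_rem; exact: AD.
  - by move=> i x y [Ai _] /mem_rem xi /mem_rem; exact: Ar xi.
  (* Neither witness is [e]: it lies in both lists, and no list contains an [r]-related pair. *)
  - move=> i j [Ai ei] [Aj ej] /(Aconf _ _ Ai Aj) [x [y [xi yj xy]]].
    exists x, y; split => //; apply: rem_mem => //; apply/eqP => xe.
      by case: xy; rewrite xe; apply: (Ar _ _ _ Aj).
    by case: xy; rewrite xe; apply: (Ar _ _ _ Ai).
apply: contrapT => nA; have [U [UU UA Uco]] := ultra_cocountable nA.
pose V x b : set I := [set j | A j /\ exists2 y, onth (p j) b = Some y & r x y].
have below z : D z -> countable [set x | D x /\ r x z].
  by move=> Dz; apply: r_chain => [x []//|x y [Dx xz] [Dy yz]]; exact: r_tree xz yz.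
have pick i : A i -> exists x b, x \in p i /\ U (V x b).
  move=> Ai.
  (* Outside this countable set of indices, no member of [p j] is a predecessor of a member of
     [p i], so conflicts run from [p i] to [p j]. *)
  pose bad := \bigcup_(z in [set` p i]) \bigcup_(x in [set x | D x /\ r x z])
    [set j | A j /\ x \in p j].
  have cbad : countable bad.
    apply: bigcup_countable => [|z /= zi].
      by apply: finite_set_countable; exact: finite_seq.
    by apply: bigcup_countable => [|//]; apply: below; exact: AD zi.
  have := @ultra_bigcup_seq I (E * nat)%type U (fun e => V e.1 e.2)
     [seq (x, b) | x <- p i, b <- iota 0 k.+1] (A `&` ~` ([set i] `|` bad)) UU.
  case.
  - by apply: filterI UA _; apply/Uco/countableU => //; exact: countable1.
  - move=> j [Aj nj]; have ij : i <> j by move=> ij; apply: nj; left.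
    have [x [y [xi yj [xy|yx]]]] := Aconf _ _ Ai Aj ij; last first.
      case: nj; right; exists x => //; exists y => //; split => //.
      exact: AD Aj yj.
    exists (x, index y (p j)).
      apply/allpairsP; exists (x, index y (p j)); split => //.
      rewrite mem_iota add0n /= (leq_trans _ (Ak _ Aj)) // index_mem //.
    split => //; exists y => //=; rewrite onthE.
    by rewrite (nth_map y) ?index_mem// nth_index.
  - move=> [x b] /allpairsP [[x' b'] [/= xi _ [-> ->]]] UV.
    by exists x', b'.
pose C b : set E := [set x | D x /\ U (V x b)].
have cC b : countable (C b).
  apply: r_chain => [x []//|x y [Dx Ux] [Dy Uy]].
  have [j [[Aj [z jz xz]] [_ [z' + yz]]]] :=
    @filter_ex _ U _ _ (filterI Ux Uy).
  rewrite jz => -[zz]; rewrite -{}zz in yz.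
  apply: (r_tree _ _ _ xz yz) => //; apply: AD Aj _.
  by apply/onthP; exists b; rewrite jz.
apply: nA; apply: (@countable_sub _ _ (\bigcup_(b in [set: nat])
   \bigcup_(x in C b) [set i | A i /\ x \in p i])).
  move=> i Ai; have [x [b [xi UV]]] := pick i Ai.
  exists b => //; exists x; split => //; exact: AD xi.
apply: bigcup_countable => // b _.
by apply: bigcup_countable => // x _.
Qed.

End FiniteConditions.

Lemma inj_on_card_le T U (A : set T) (B : set U) (f : T -> U) :
  {in A &, injective f} -> f @` A `<=` B -> A #<= B.
Proof.
move=> /inj_card_eq; rewrite card_eq_sym => /card_eqPle[fA _] /subset_card_le.
exact: card_le_trans.
Qed.

(* [K] minus a finite set is partitioned by a maximal family [G] of disjoint
   injective sequences. *)
Lemma card_mul_nat (K : Type) :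
  infinite_set [set: K] -> [set: K * nat] #<= [set: K].
Proof.
elim/Ppointed: K => K Kinf; first by case: Kinf; rewrite emptyE.
pose P (G : set (nat -> K)) := forall g g' n n', G g -> G g' ->
  g n = g' n' -> g = g' /\ n = n'.
have [F FP Ftot|G [PG Gmax]] := @Zorn_bigcup _ P.
  move=> g g' n n' [A FA Ag] [B FB Bg'].
  by have [AB|BA] := Ftot _ _ FA FB;
    [apply: (FP _ FB) => //; exact: AB|apply: (FP _ FA) => //; exact: BA].
pose U : set K := [set k | exists g n, G g /\ g n = k].
(* An infinite complement would contain an injective sequence, and adding it to [G] would contradict
   maximality. *)
have finU : finite_set (~` U).
  apply: contrapT => /infiniteP/pcard_leP/unsquash f.
  pose f' : nat -> K := f.
  have finj n n' : f' n = f' n' -> n = n'.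
    by move=> ff; apply: (@inj _ _ _ f) ff; rewrite inE.
  have fU n : ~ U (f' n) by exact: (@funS _ _ _ _ f).
  apply: (Gmax (G `|` [set f'])).
    split=> [g Gg|/(_ f')]; first by left.
    by move=> /(_ (or_intror erefl)) Gf; apply: (fU 0%N); exists f', 0%N.
  move=> g g' n n' [Gg|->] [Gg'|->] gg'; first exact: PG.
  - by case: (fU n'); rewrite -gg'; exists g, n.
  - by case: (fU n); rewrite gg'; exists g', n'.
  - by split => //; exact: finj.
have [g0 Gg0] : exists g, G g.
  apply: contrapT => nG; apply: Kinf; apply: sub_finite_set finU.
  by move=> k _ [g [n [Gg _]]]; apply: nG; exists g.
have [i iinj] : exists i : K -> nat, {in ~` U &, injective i}.
  exact/countable_injP/finite_set_countable.
(* Points of [U] receive a sequence through them and twice their position in it; the finitely many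
   others receive [g0] and an odd number. *)
have /choice[e eP] : forall k, exists e : (nat -> K) * nat, G e.1 /\
    ((exists n, e.2 = n.*2 /\ e.1 n = k) \/
     (~ U k /\ e = (g0, (i k).*2.+1))).
  move=> k; have [[g [n [Gg gn]]]|nU] := pselect (U k).
    by exists (g, n.*2); split => //; left; exists n.
  by exists (g0, (i k).*2.+1); split => //; right.
have einj : injective e.
  move=> k k' ee; have [_ [[n [en ek]]|[nU ek]]] := eP k;
    have [_ [[n' [en' ek']]|[nU' ek']]] := eP k'.
  - by rewrite -ek -ek' ee; congr (_ _); apply: double_inj; rewrite -en -en' ee.
  - by move: (congr1 odd en); rewrite ee ek' /= !odd_double.
  - by move: (congr1 odd en'); rewrite -ee ek /= !odd_double.
  - apply: iinj; rewrite ?inE //; apply: double_inj; apply: succn_inj.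
    by move: ee; rewrite ek ek' => -[->].
pose j (x : nat * nat) := choice.pickle x.
have jinj : injective j := pcan_inj choice.pickleK.
apply: (@inj_on_card_le _ _ _ _
  (fun x : K * nat => (e x.1).1 (j ((e x.1).2, x.2)))) => //.
move=> [k n] [k' n'] _ _ /= /(PG _ _ _ _ (eP k).1 (eP k').1).
move=> [e1 /jinj[e2 ->]]; congr (_, _); apply: einj.
by move: e1 e2; case: (e k) (e k') => [? ?] [? ?] /= -> ->.
Qed.

(** * Forcing with finite approximations to a colouring *)

Section ColourForcing.
Variables (X : choiceType) (J : set X) (r : X -> X -> Prop).

(* A point may carry several colours: two conditions are then compatible unless
   they give one colour to two [r]-related points, and no Delta-system argument
   is needed for ccc. *)
Record condition := Condition {
  support :> set (X * nat) ;
  support_finite : finite_set support ;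
  support_dom : forall x n, support (x, n) -> J x ;
  support_free : forall x y n, support (x, n) -> support (y, n) -> ~ r x y }.

HB.instance Definition _ := gen_eqMixin condition.
HB.instance Definition _ := gen_choiceMixin condition.

Lemma condition_eq (p q : condition) : support p = support q -> p = q.
Proof.
case: p q => [p p1 p2 p3] [q q1 q2 q3] /= pq; rewrite {}pq in p1 p2 p3 *.
by congr Condition; exact: Prop_irrelevance.
Qed.

Definition condition_le (p q : condition) : bool := `[< q `<=` p >].

Let condition_refl : reflexive condition_le.
Proof. by move=> p; apply/asboolP. Qed.

Let condition_anti : antisymmetric condition_le.
Proof.
move=> p q /andP[/asboolP qp /asboolP pq].
by apply: condition_eq; apply/seteqP.
Qed.

Let condition_trans : transitive condition_le.
Proof.
by move=> q p t /asboolP qp /asboolP tq; apply/asboolP; exact: subset_trans qp.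
Qed.

HB.instance Definition _ := Order.Le_isPOrder.Build (Order.Disp tt tt) condition
  condition_refl condition_anti condition_trans.

Definition empty_condition : condition.
Proof. by refine (@Condition set0 _ _ _) => //; exact: finite_set0. Defined.

Let condition_lex1 (p : condition) : p <= empty_condition.
Proof. by apply/asboolP => ? []. Qed.

HB.instance Definition _ := Order.hasTop.Build (Order.Disp tt tt) condition
  condition_lex1.

Lemma condition_leP (p q : condition) : p <= q <-> q `<=` p.
Proof. by split=> /asboolP. Qed.

Hypothesis r_irr : forall x, ~ r x x.
Hypothesis r_tree : forall x y z, J x -> J y -> J z ->
  r x z -> r y z -> x = y \/ r x y \/ r y x.
Hypothesis r_chain : forall C : set X, C `<=` J ->
  (forall x y, C x -> C y -> x = y \/ r x y \/ r y x) -> countable C.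

Lemma condition_union (p q : condition) :
  (forall x y n, support p (x, n) -> support q (y, n) -> ~ r x y /\ ~ r y x) ->
  compatible p q.
Proof.
move=> pq.
have pqf : finite_set (support p `|` support q).
  by rewrite finite_setU; split; exact: support_finite.
have pqd x n : (support p `|` support q) (x, n) -> J x by move=> [] /support_dom.
have pqr x y n : (support p `|` support q) (x, n) ->
    (support p `|` support q) (y, n) -> ~ r x y.
  move=> [xp|xq] [yp|yq].
  - exact: support_free xp yp.
  - exact: (pq _ _ _ xp yq).1.
  - exact: (pq _ _ _ yp xq).2.
  - exact: support_free xq yq.
by exists (Condition pqf pqd pqr); split; apply/condition_leP; [left|right].
Qed.

(** Conditions with at most [k] pairs are treated for each [k]. Two incompatible ones give one
    colour to [r]-related points, and a chain of [rE] splits into [r]-chains, one for each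
    colour. *)
Lemma condition_ccc : ccc condition.
Proof.
move=> A antiA.
have /choice[s sP] : forall p : condition, exists s : seq (X * nat), support p = [set` s].
  by move=> p; apply/finite_seqP; exact: support_finite.
apply: (@countable_sub _ _
  (\bigcup_(k in [set: nat]) [set p | A p /\ (size (s p) <= k)%N])).
  by move=> p Ap; exists (size (s p)).
apply: bigcup_countable => // k _.
pose rE (e f : X * nat) := e.2 = f.2 /\ r e.1 f.1.
apply: (@countable_conflict _ rE [set e | J e.1] _ _ _ k s).
- move=> [x a] [y b] [z c] /= Jx Jy Jz [/= -> xz] [/= -> yz].
  by have [->|[xy|yx]] := r_tree Jx Jy Jz xz yz; [left|right; left|right; right].
- move=> C CJ Cc.
  have cC n : countable [set x | C (x, n)].
    apply: r_chain => [x /CJ //|x y /= xn yn].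
    by have [[->]|[[]|[]]] := Cc _ _ xn yn; [left|right; left|right; right].
  apply: (@countable_sub _ _ (\bigcup_(n in [set: nat])
    ((fun x => (x, n)) @` [set x | C (x, n)]))).
    by move=> [x n] Cxn; exists n => //; exists x.
  apply: bigcup_countable => // n _.
  exact: sub_countable (card_image_le _ _) (cC n).
- by move=> p [].
- move=> p [x n] _ xp /=; apply: (@support_dom p x n).
  by rewrite sP.
- move=> p [x n] [y m] _ xp yp [/= nm]; rewrite -{}nm in yp.
  by apply: (@support_free p x y n); rewrite sP.
- move=> p q [Ap _] [Aq _] pq; apply: contrapT => nconf.
  apply: (antiA _ _ Ap Aq pq); apply: condition_union => x y n.
  rewrite !sP => xp yq; split => rxy; apply: nconf;
    exists (x, n), (y, n); split => //.
    by left.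
  by right.
Qed.

Lemma martin_colouring (K : Type) : martin_axiom K -> J #<= [set: K] ->
  exists F : X -> nat, forall x y, J x -> J y -> r x y -> F x <> F y.
Proof.
elim/Ppointed: K => K MA JK.
  exists (fun=> 0%N) => x y Jx; suff : J = set0 by move=> J0; rewrite J0 in Jx.
  by move: JK; rewrite emptyE => /eqP.
have /pcard_injP[i iinj] := JK.
pose Dn k := [set p : condition | forall x, J x -> i x = k -> exists n, support p (x, n)].
have Ddense k : forcing_dense (Dn k).
  move=> p; have [[x [Jx ix]]|nx] := pselect (exists x, J x /\ i x = k); last first.
    by exists p => // x Jx ix; case: nx; exists x.
  have [n np] : exists n, forall y, ~ support p (y, n).
    have /finite_seqP[s sE] : finite_set (snd @` p).
      by apply: finite_image; exact: support_finite.
    exists (\max_(m <- s) m).+1 => y yp.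
    have : [set` s] (\max_(m <- s) m).+1 by rewrite -sE; exists (y, (\max_(m <- s) m).+1).
    by move=> /= /(@leq_bigmax_seq _ _ xpredT id)/(_ isT); rewrite ltnn.
  have f1 : finite_set [set (x, n)] by exact: finite_set1.
  have f2 y m : [set (x, n)] (y, m) -> J y by move=> [->].
  have f3 y z m : [set (x, n)] (y, m) -> [set (x, n)] (z, m) -> ~ r y z.
    by move=> [-> _] [-> _]; exact: r_irr.
  have [|q [qp qx]] := @condition_union p (Condition f1 f2 f3).
    by move=> y z m /= yp [_ mn]; case: (np y); rewrite -mn.
  exists q; last exact: qp.
  move=> y Jy iy; have -> : y = x by apply: iinj; rewrite ?inE // iy.
  by exists n; move/condition_leP : qx; apply.
have [G [[_ _ Gdir] GD]] := MA _ _ condition_ccc _ Ddense.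
have /choice[F FP] : forall x, exists n, J x -> exists2 p, G p & support p (x, n).
  move=> x; have [Jx|nJ] := pselect (J x); last by exists 0%N.
  have [p [Gp /(_ x Jx erefl)[n pxn]]] := GD (i x).
  by exists n => _; exists p.
exists F => x y Jx Jy rxy Fxy.
have [p Gp px] := FP _ Jx; have [q Gq qy] := FP _ Jy.
have [t [_ /condition_leP tp /condition_leP tq]] := Gdir _ _ Gp Gq.
by apply: (@support_free t x y (F x)) rxy; [exact: tp|rewrite Fxy; exact: tq].
Qed.

End ColourForcing.

(** * Coordinates along branches *)

(** Zorn is applied to the sets whose union with [C] is linear, a property that the empty set has as
    well. *)
Lemma branch_extension d (X : porderType d) (C : set X) :
  linearly_ordered C -> exists2 B, branch B & C `<=` B.
Proof.
move=> Clin.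
have [F FP Ftot|A [Alin Amax]] := @Zorn_bigcup _
  (fun A : set X => linearly_ordered (A `|` C)).
  move=> x y [[A FA Ax]|Cx] [[B FB By]|Cy].
  - have [AB|BA] := Ftot _ _ FA FB.
      by apply: (FP _ FB); left => //; exact: AB.
    by apply: (FP _ FA); left => //; exact: BA.
  - by apply: (FP _ FA); [left|right].
  - by apply: (FP _ FB); [right|left].
  - exact: Clin.
exists (A `|` C); last by right.
split => // D Dlin ACD; apply/seteqP; split => // x Dx; left.
apply: contrapT => nAx; apply: (Amax D).
  split=> [y Ay|]; first by apply: ACD; left.
  by move=> /(_ x Dx).
by rewrite setUidl // => y Cy; apply: ACD; right.
Qed.

Lemma itv_between (R : realType) (i : interval R) (a b t : R) :
  a \in i -> b \in i -> a <= t -> t <= b -> t \in i.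
Proof.
case: i => l r; rewrite !itv_boundlr => /andP[la _] /andP[_ br] at_ tb.
by rewrite (le_trans la) ?(le_trans _ br).
Qed.

(** Take the strict part of a reflexive well-order: uniqueness of minima of pairs gives
    antisymmetry, and a least inaccessible point would be accessible. *)
Lemma well_order_exists (T : eqType) : exists prec : T -> T -> Prop,
  well_founded prec /\ forall x y, [\/ x = y, prec x y | prec y x].
Proof.
have [W Wwo] := well_ordering_principle T.
have least (A : set T) : A !=set0 -> exists2 a, A a & forall b, A b -> W a b.
  move=> [x Ax]; have [|a [[aA aW] _]] := Wwo [pred z | `[< A z >]].
    by exists x; apply/asboolP.
  exists a; first exact/asboolP.
  by move=> b Ab; apply: aW; apply/asboolP.
have anti x y : W x y -> W y x -> x = y.
  move=> xy yx.
  have Wr z : W z z.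
    by have [|a -> /(_ z erefl)] := least [set z]; first by exists z.
  have [|a [_ au]] := Wwo (pred2 x y); first by exists x; rewrite !inE eqxx.
  have xa : a = x by apply: au; split; [rewrite !inE eqxx|move=> ? /pred2P[]->].
  have ya : a = y by apply: au; split; [rewrite !inE eqxx orbT|move=> ? /pred2P[]->].
  by rewrite -xa.
exists (fun x y => x <> y /\ W x y); split; last first.
  move=> x y; have [<-|xy] := eqVneq x y; first exact: Or31.
  have [|a [->|->] aW] := least [set x; y]; first by exists x; left.
    by apply: Or32; split; [exact/eqP|apply: aW; right].
  by apply: Or33; split; [apply/eqP; rewrite eq_sym|apply: aW; left].
move=> x; apply: contrapT => nx.
have [|a na aW] := least [set x | ~ Acc (fun x y => x <> y /\ W x y) x].
  by exists x.
apply: na; constructor => b [ba Wba]; apply: contrapT => nb; apply: ba.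
by apply: anti => //; exact: aW.
Qed.

Section Coordinates.
Variables (R : realType) (d : Order.disp_t) (X : bPOrderType d).
Hypothesis hX : branchwise_real R X.

Lemma below_total (x u v : X) : u <= x -> v <= x -> u <= v \/ v <= u.
Proof. by case: hX => tX _ _ ux vx; exact: (tX x). Qed.

Lemma meet_exists (x y : X) : exists m : X,
  [/\ m <= x, m <= y & forall w, w <= x -> w <= y -> w <= m].
Proof.
case: hX => _ _ /(_ x y)[m [lm gm]]; exists m; split.
- by apply: lm; left.
- by apply: lm; right.
- by move=> w wx wy; apply: gm => ? [->|->].
Qed.

Lemma chain_coordinate (C : set X) : linearly_ordered C ->
  exists (B : set X) (f : X -> R) (i : interval R), C `<=` B /\ order_iso_on B [set` i] f.
Proof.
move=> /branch_extension[B Bb CB]; case: hX => _ /(_ B Bb)[i [f fP]] _.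
by exists B, f, i.
Qed.

(** A chain embeds in the reals. Unless it has a maximum, choosing for each rational an element with
    larger coordinate, where there is one, gives a cofinal set. *)
Lemma chain_cofinal (C : set X) : linearly_ordered C ->
  exists W : set X, [/\ W `<=` C, countable W &
    forall c, C c -> exists2 w, W w & c <= w].
Proof.
move=> /chain_coordinate[B [f [i [CB [_ fmono]]]]].
have fle x y : C x -> C y -> (f x <= f y) = (x <= y).
  by move=> /CB Bx /CB By; rewrite fmono ?inE.
have [[m [Cm mmax]]|nomax] := pselect (exists m, C m /\ forall c, C c -> c <= m).
  exists [set m]; split; [by move=> ? ->|exact: countable1|].
  by move=> c Cc; exists m => //; exact: mmax.
have /choice[g gP] : forall q : rat, exists w : X,
    (exists2 c, C c & ratr q < f c) -> C w /\ ratr q < f w.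
  move=> q; have [[c Cc qc]|nc] := pselect (exists2 c, C c & ratr q < f c).
    by exists c.
  by exists \bot => /nc.
exists ((g @` [set: rat]) `&` C); split => [x []//||c Cc].
  apply: (@countable_sub _ _ (g @` [set: rat])) => [x []//|].
  exact: sub_countable (card_image_le _ _) (countableP _).
have [c' [Cc' cc']] : exists c', C c' /\ f c < f c'.
  apply: contrapT => nc; apply: nomax; exists c; split => // c' Cc'.
  by rewrite -fle // leNgt; apply/negP => cc'; apply: nc; exists c'.
have [q] := rat_in_itvoo cc'; rewrite in_itv /= => /andP[cq qc'].
have [|Cw qw] := gP q; first by exists c'.
exists (g q); first by split => //; exists q.
by rewrite -fle // (le_trans (ltW cq) (ltW qw)).
Qed.

(** The coordinate of a branch containing the segment below [x] is rescaled; intermediate values are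
    attained because the branch maps onto an interval. *)
Lemma coordinate_exists (x : X) : exists h : X -> R,
  [/\ (forall u v, u <= x -> v <= x -> (h u <= h v) = (u <= v)),
      (forall u v t, u <= v -> v <= x -> h u <= t -> t <= h v ->
         exists w, [/\ u <= w, w <= v & h w = t])
    & (forall u, u <= x -> 0 <= h u <= 1)].
Proof.
have [|B [f [i [CB [[fB _ fsurj] fmono]]]]] := @chain_coordinate [set u | u <= x].
  by move=> u v; exact: below_total.
have fle u v : u <= x -> v <= x -> (f u <= f v) = (u <= v).
  by move=> ux vx; rewrite fmono ?inE //; exact: CB.
(* Adding 1 keeps the divisor positive when [x] is [\bot]. *)
pose D := f x - f \bot + 1.
have D0 : 0 < D by have := fle _ _ (le0x x) (lexx x); rewrite le0x /D; lra.
exists (fun u => (f u - f \bot) / D); split.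
- by move=> u v ux vx; rewrite ler_pM2r ?invr_gt0 // lerD2r fle.
- move=> u v t uv vx; rewrite ler_pdivrMr // ler_pdivlMr // => ut tv.
  have ux := le_trans uv vx.
  have [|w Bw fw] := fsurj (t * D + f \bot).
    apply: (@itv_between _ i (f u) (f v)); [| |lra|lra];
      by apply: fB; exact: CB.
  exists w; split.
  + by rewrite -fmono ?inE //; [lra|exact: CB].
  + by rewrite -fmono ?inE //; [lra|exact: CB].
  + by rewrite fw addrK mulfK // gt_eqF.
- move=> u ux; have := fle _ _ (le0x x) ux; have := fle _ _ ux (lexx x).
  by rewrite le0x ux => h1 h2; rewrite divr_ge0 ?ler_pdivrMr ?mul1r /D; lra.
Qed.

End Coordinates.

(** * Functions without jumps *)

Section Gradings.
Variables (R : realType) (d : Order.disp_t) (X : bPOrderType d).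
Hypothesis hX : branchwise_real R X.

Lemma coordinate_lt (x : X) (h : X -> R) :
  (forall u v, u <= x -> v <= x -> (h u <= h v) = (u <= v)) ->
  forall u v, u <= x -> v <= x -> (h u < h v) = (u < v).
Proof. by move=> hle u v ux vx; rewrite !lt_leAnge !hle. Qed.

(** The supremum is formed among the coordinates and pulled back, since no intermediate value is
    omitted; for empty [A] it is [\bot]. *)
Lemma sup_below (x : X) (A : set X) : (forall a, A a -> a <= x) ->
  exists s, [/\ s <= x, forall a, A a -> a <= s &
    forall w, w < s -> exists2 a, A a & w < a].
Proof.
move=> Ax; have [h [hle hsurj _]] := coordinate_exists hX x.
have [[a0 Aa0]|A0] := pselect (A !=set0); last first.
  exists \bot; split; [exact: le0x|by move=> a Aa; case: A0; exists a|].
  by move=> w; rewrite ltx0.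
have hub : ubound (h @` A) (h x) by move=> _ [a Aa <-]; rewrite hle // Ax.
have hA0 : (h @` A) !=set0 by exists (h a0), a0.
have supA : ubound (h @` A) (sup (h @` A)) by apply: ub_le_sup; exists (h x).
have [||||s [_ sx hs]] := hsurj a0 x (sup (h @` A)) _ _ _ _ => //.
- exact: Ax.
- by apply: supA; exists a0.
- exact: ge_sup.
exists s; split => // [a Aa|w ws].
  by rewrite -(hle _ _ (Ax _ Aa) sx) hs; apply: supA; exists a.
have wx := ltW (lt_le_trans ws sx).
have : h w < sup (h @` A) by rewrite -hs (coordinate_lt hle).
move=> /(sup_gt hA0)[_ [a Aa <-]].
by rewrite (coordinate_lt hle wx (Ax _ Aa)) => wa; exists a.
Qed.

(* For monotone [f] this says that [f] has no jumps, i.e. is continuous on every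
   segment. *)
Definition gradual (f : X -> R) := forall e : R, 0 < e ->
  (forall z, \bot < z -> exists2 w, w < z & f z < f w + e) /\
  (forall z y, z < y -> exists w, [/\ z < w, w <= y & f w < f z + e]).

(** At the supremum [s] of the points of the segment with value at most [t], either strict
    inequality between [f s] and [t] would make a jump. *)
Lemma gradual_surj (f : X -> R) : {homo f : x y / x < y} -> gradual f ->
  forall x y t, x <= y -> f x <= t -> t <= f y ->
  exists z, [/\ x <= z, z <= y & f z = t].
Proof.
move=> fhomo fgr x y t xy fxt tfy.
pose A := [set z | [/\ x <= z, z <= y & f z <= t]].
have [a []//|s [sy As sA]] := @sup_below y A.
have xs : x <= s by apply: As.
exists s; split => //; apply/le_anti/andP; split; rewrite leNgt; apply/negP => lt_t.
- have xs' : x < s.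
    by rewrite lt_neqAle xs andbT; apply: contraTneq lt_t => <-; rewrite -leNgt.
  have [|/(_ s (le_lt_trans (le0x x) xs'))[w ws fw] _] := fgr (f s - t).
    by rewrite subr_gt0.
  by have [a [_ _ fat] /fhomo wa] := sA w ws; clear -fw fat wa; lra.
- have sy' : s < y.
    by rewrite lt_neqAle sy andbT; apply: contraTneq lt_t => ->; rewrite -leNgt.
  have [|_ /(_ s y sy')[w [sw wy fw]]] := fgr (t - f s).
    by rewrite subr_gt0.
  suff Aw : A w by have := As _ Aw; rewrite (lt_geF sw).
  by split => //; [exact: le_trans xs (ltW sw)|clear -fw; lra].
Qed.

Lemma gradual_gradable (f : X -> R) : {homo f : x y / x < y} -> gradual f ->
  continuously_gradable R X.
Proof.
move=> fhomo fgr; exists f; split => // x y xy.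
have fle u v : u <= y -> v <= y -> (f u <= f v) = (u <= v).
  move=> uy vy; apply/idP/idP; last first.
    by rewrite le_eqVlt => /orP[/eqP->//|/fhomo/ltW].
  have [//|vu] := below_total hX uy vy.
  by move: vu; rewrite le_eqVlt => /orP[/eqP->//|/fhomo]; rewrite ltNge => /negbTE->.
have fmono : {in `[x, y]%classic &, {mono f : u v / u <= v}}.
  by move=> u v; rewrite !inE /= !in_itv /= => /andP[_ uy] /andP[_ vy]; exact: fle.
split => //; split.
- move=> u /=; rewrite !in_itv /= => /andP[xu uy].
  by rewrite !fle // ?xu // ltW.
- by move=> u v ux vx fuv; apply/le_anti; rewrite -!fmono // fuv lexx.
- move=> t /=; rewrite in_itv /= => /andP[xt ty].
  have [z [xz zy <-]] := gradual_surj fhomo fgr (ltW xy) xt ty.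
  by exists z => //=; rewrite in_itv /= xz.
Qed.

Lemma gradual_cst (c : R) : gradual (fun=> c).
Proof.
move=> e e0; split=> [z z0|z y zy]; first by exists \bot => //; clear -e0; lra.
by exists y; split => //; clear -e0; lra.
Qed.

Lemma gradual_scale (f : X -> R) (c : R) : 0 < c -> gradual f ->
  gradual (fun x => f x * c).
Proof.
move=> c0 fgr e e0; have [|fl fr] := fgr (e / c); first exact: divr_gt0.
split=> [z /fl[w wz fw]|z y /fr[w [zw wy fw]]]; exists w => //; last split => //.
  by rewrite -(mulfVK (lt0r_neq0 c0) e) -mulrDl ltr_pM2r.
by rewrite -(mulfVK (lt0r_neq0 c0) e) -mulrDl ltr_pM2r.
Qed.

(** Monotonicity lets one point serve both functions: the larger witness on the left, the smaller on
    the right. *)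
Lemma gradual_add (f g : X -> R) : {homo f : x y / x <= y} ->
  {homo g : x y / x <= y} -> gradual f -> gradual g ->
  gradual (fun x => f x + g x).
Proof.
move=> fh gh fgr ggr e e0; have e2 : 0 < e / 2%:R by lra.
have [[fl fr] [gl gr]] := (fgr _ e2, ggr _ e2).
split=> [z z0|z y zy].
  have [[v vz fv] [w wz gw]] := (fl _ z0, gl _ z0).
  have [vw|wv] := below_total hX (ltW vz) (ltW wz).
    by exists w => //; have := fh _ _ vw; clear -fv gw; lra.
  by exists v => //; have := gh _ _ wv; clear -fv gw; lra.
have [[v [zv vy fv]] [w [zw wy gw]]] := (fr _ _ zy, gr _ _ zy).
have [vw|wv] := below_total hX vy wy.
  by exists v; split => //; have := gh _ _ vw; clear -fv gw; lra.
by exists w; split => //; have := fh _ _ wv; clear -fv gw; lra.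
Qed.

(** * Weighted sums of a separating sequence of gradual functions *)

Section Series.
Variable psi : nat -> X -> R.
Hypothesis psi_itv : forall n x, 0 <= psi n x <= 1.
Hypothesis psi_homo : forall n, {homo psi n : x y / x <= y}.
Hypothesis psi_gradual : forall n, gradual (psi n).
Hypothesis psi_sep : forall x y, x < y -> exists n, psi n x < psi n y.

Let w n : R := (2%:R ^+ n)^-1.
Let S N x := \sum_(n < N) psi n x * w n.+1.

Let w_gt0 n : 0 < w n. Proof. by rewrite invr_gt0 exprn_gt0. Qed.

Let w_half n : w n = w n.+1 + w n.+1.
Proof. by rewrite /w exprS invfM; lra. Qed.

Let SS N x : S N.+1 x = S N x + psi N x * w N.+1.
Proof. by rewrite /S big_ord_recr. Qed.

Let S_mono x : {homo (S ^~ x) : m n / (m <= n)%N >-> m <= n}.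
Proof.
apply: homo_leq => [//|? ? ?|n]; first exact: le_trans.
by rewrite SS lerDl mulr_ge0 ?(ltW (w_gt0 _)) //; case/andP: (psi_itv n x).
Qed.

Let S_tail x M N : S M x <= S N x + w N.
Proof.
(* The upper bounds [S n x + w n] do not increase with [n], since term [n] is at most [w n.+1], half
   of [w n]. *)
pose T n := - (S n x + w n).
have Tm : {homo T : m n / (m <= n)%N >-> m <= n}.
  apply: homo_leq => [//|? ? ?|n]; first exact: le_trans.
  rewrite /T SS (w_half n); have /andP[_ p1] := psi_itv n x.
  have := ler_wpM2r (ltW (w_gt0 n.+1)) p1; lra.
have := Tm _ _ (leq_maxr M N); have := S_mono x (leq_maxl M N).
have := w_gt0 (maxn M N); rewrite /T; lra.
Qed.

Let S_homo N : {homo S N : x y / x <= y}.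
Proof.
move=> x y xy; apply: ler_sum => n _.
by rewrite ler_pM2r // psi_homo.
Qed.

Let S_gradual N : gradual (S N).
Proof.
elim: N => [|N IH].
  have -> : S 0 = fun=> 0 by apply/funext => x; rewrite /S big_ord0.
  exact: gradual_cst.
have -> : S N.+1 = fun x => S N x + psi N x * w N.+1.
  by apply/funext => x; rewrite SS.
apply: gradual_add => //; last exact: gradual_scale.
by move=> x y xy; rewrite ler_pM2r // psi_homo.
Qed.

Let l x := sup (range (S ^~ x)).

Let S_sup x : has_sup (range (S ^~ x)).
Proof.
split; first by exists (S 0 x), 0%N.
by exists (S 0 x + w 0) => _ [n _ <-]; exact: S_tail.
Qed.

Let S_le_l N x : S N x <= l x.
Proof. by apply: ub_le_sup; [exact: (S_sup x).2|exists N]. Qed.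

Let l_le x b : (forall N, S N x <= b) -> l x <= b.
Proof.
by move=> Sb; apply: ge_sup; [exact: (S_sup x).1|move=> _ [n _ <-]; exact: Sb].
Qed.

Let l_homo : {homo l : x y / x < y}.
Proof.
move=> x y xy; have [k xyk] := psi_sep xy.
(* Term [k] alone contributes [c] and no other term contributes a negative amount, so the gap
   survives in the supremum. *)
pose c := (psi k y - psi k x) * w k.+1.
have c0 : 0 < c by rewrite mulr_gt0 // subr_gt0.
suff : l x <= l y - c by clear xy; lra.
have Sk N : S N.+1 x - S N x <= S N.+1 y - S N y.
  rewrite !SS [S N x + _]addrC [S N y + _]addrC !addrK ler_pM2r //.
  exact/psi_homo/ltW.
have Skc N : S (k.+1 + N) x + c <= S (k.+1 + N) y.
  elim: N => [|N IH].
    by have := S_homo k (ltW xy); rewrite addn0 !SS /c mulrBl; clear xy; lra.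
  by rewrite addnS; have := Sk (k.+1 + N); clear xy; lra.
apply: l_le => N; have := S_le_l (k.+1 + N) y; have := Skc N.
by have := S_mono x (leq_addl k.+1 N); clear xy; lra.
Qed.

(** The convergence is uniform: once [w N] is below [e / 2], [l] is that close to the gradual
    function [S N]. *)
Let l_gradual : gradual l.
Proof.
move=> e e0; have e2 : 0 < e / 2%:R by lra.
have [N wN] : exists N, w N < e / 2%:R.
  have [N /upper_nthrootP eN] : exists N, (Num.bound (e / 2%:R)^-1 <= N)%N.
    by exists (Num.bound (e / 2%:R)^-1).
  exists N; rewrite /w -[ltRHS]invrK ltf_pV2 // posrE ?invr_gt0 //.
  by rewrite exprn_gt0.
have lS z : l z <= S N z + w N by apply: l_le => M; exact: S_tail.
have [gl gr] := S_gradual N e2.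
split=> [z /gl[v vz zv]|z y /gr[v [zv vy Sv]]].
  by exists v => //; have := lS z; have := S_le_l N v; clear vz; lra.
by exists v; split => //; have := lS v; have := S_le_l N z; clear zv vy; lra.
Qed.

Lemma series_gradable : continuously_gradable R X.
Proof. exact: gradual_gradable l_homo l_gradual. Qed.

End Series.

End Gradings.

(** * Bumps and their cones *)

Section Bump.
Variables (R : realType) (d : Order.disp_t) (X : bPOrderType d).
Hypothesis hX : branchwise_real R X.

(** With [h] the coordinate below [x] and [m z] the meet of [x] and [z], the bump is the part of
    [h (m z)] above [h s]: it rises from [s] to [x] and stays constant beyond the point where a path
    leaves that segment. *)
Lemma bump_exists (x s : X) : s <= x -> exists f : X -> R,
  [/\ forall z, 0 <= f z <= 1, {homo f : y z / y <= z}, gradual f,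
      forall z, (0 < f z) <-> above_rel s x z
    & forall y z, y < z -> z <= x -> s < z -> f y < f z].
Proof.
move=> sx; have [h [hle hsurj h01]] := coordinate_exists hX x.
have hlt := coordinate_lt hle.
have /choice[m mP] := meet_exists hX x.
have mx z : m z <= x by case: (mP z).
have mz z : m z <= z by case: (mP z).
have mglb z w : w <= x -> w <= z -> w <= m z by case: (mP z) => _ _; apply.
have mid z : z <= x -> m z = z.
  by move=> zx; apply/le_anti; rewrite mz mglb.
have mmono y z : y <= z -> m y <= m z.
  by move=> yz; apply: mglb => //; exact: le_trans (mz y) yz.
pose f z : R := Num.max 0 (h (m z) - h s).
have fhomo : {homo f : y z / y <= z}.
  move=> y z yz; rewrite /f ge_max !le_max lexx /=.
  by rewrite lerD2r hle // mmono // orbT.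
have fm z : f z = f (m z) by rewrite /f (mid (m z)).
exists f; split => //.
- move=> z; rewrite le_max lexx /= ge_max ler01 /=.
  have /andP[hs0 _] := h01 _ sx; have /andP[_ hz1] := h01 _ (mx z); lra.
- move=> e e0; split=> [z z0|z y zy].
    (* If [z] is not below [x], the bump has equal values at [z] and [m z]; otherwise go down by
       [e / 2] in the coordinate, stopping at [\bot]. *)
    have [zx|nzx] := boolP (z <= x); last first.
      exists (m z); last by rewrite -fm ltrDl.
      by rewrite lt_neqAle mz andbT; apply: contraNneq nzx => <-.
    have hz : h \bot < h z by rewrite hlt ?le0x // (le_trans (le0x z)).
    pose t := Num.max (h \bot) (h z - e / 2%:R).
    have [||||w [_ wz hw]] := hsurj \bot z t => //.
    + by rewrite le_max lexx.
    + by rewrite ge_max ltW //=; lra.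
    have wx : w <= x := le_trans wz zx.
    have tz : t < h z by rewrite gt_max hz /=; lra.
    exists w; first by rewrite -hlt // hw.
    rewrite /f !mid // gt_max; apply/andP; split.
      by rewrite (@lt_le_trans _ _ e) // lerDr le_max lexx.
    have : h z - e / 2%:R <= t by rewrite le_max lexx orbT.
    have : h w - h s <= Num.max 0 (h w - h s) by rewrite le_max lexx orbT.
    by rewrite hw; clear z0 zx wz wx; lra.
  (* If the meets agree, the bump does not grow up to [y]; otherwise [z] lies strictly below [m y],
     and there is room to go up in the coordinate. *)
  have [yz|] := boolP (m y <= m z).
    exists y; split => //; rewrite fm [f z]fm (@le_lt_trans _ _ (f (m z))) //.
      exact: fhomo.
    by rewrite ltrDl.
  move=> nyz; have zm : z < m y.
    have [zy'|yz] := below_total hX (ltW zy) (mz y).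
      rewrite lt_neqAle zy' andbT; apply: contraNneq nyz => zE.
      by rewrite -zE mglb // zE mx.
    by case/negP: nyz; exact: mglb.
  have zx : z <= x := le_trans (ltW zm) (mx y).
  have hz : h z < h (m y) by rewrite hlt.
  pose t := Num.min (h (m y)) (h z + e / 2%:R).
  have [||||w [zw wy hw]] := hsurj z (m y) t => //.
  + exact: ltW.
  + by rewrite le_min ltW //=; lra.
  + by rewrite ge_min lexx.
  have wx : w <= x := le_trans wy (mx y).
  have tz : h z < t by rewrite lt_min hz /=; lra.
  exists w; split; first by rewrite -hlt // hw.
    exact: le_trans wy (mz y).
  rewrite /f !mid // gt_max; apply/andP; split.
    by rewrite (@lt_le_trans _ _ e) // lerDr le_max lexx.
  have : t <= h z + e / 2%:R by rewrite ge_min lexx orbT.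
  have : h z - h s <= Num.max 0 (h z - h s) by rewrite le_max lexx orbT.
  by rewrite hw; clear zy zm zx zw wy wx; lra.
- move=> z; rewrite lt_max ltxx /= subr_gt0 hlt //; split=> [sm|[w [sw wx wz]]].
    by exists (m z).
  exact: lt_le_trans sw (mglb _ _ wx wz).
- move=> y z yz zx sz; have yx := le_trans (ltW yz) zx.
  have hsz : h s < h z by rewrite hlt.
  have hyz : h y < h z by rewrite hlt.
  rewrite /f !mid // gt_max; apply/andP; split; rewrite lt_max; apply/orP; right.
    by rewrite subr_gt0.
  by rewrite ltrD2r.
Qed.

End Bump.

Section Cones.
Variables (R : realType) (d : Order.disp_t) (X : bPOrderType d).
Hypothesis hX : branchwise_real R X.

Lemma above_rel_up (s x y z : X) : above_rel s x y -> y <= z -> above_rel s x z.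
Proof. by move=> [w [sw wx wy]] yz; exists w; split=> //; exact: le_trans yz. Qed.

Lemma cone_total (x y s t p : X) : above_rel s x p -> above_rel t y p ->
  s <= t \/ t <= s.
Proof.
move=> [u [su ux up]] [v [tv vy vp]]; apply: (@below_total _ _ _ hX p).
  exact: le_trans (ltW su) up.
exact: le_trans (ltW tv) vp.
Qed.

(** The points [p] and [z] share a lower bound above [t], hence above [s], so [z] is connected to
    [x] through [p]. *)
Lemma cone_nested (x y s t p : X) : above_rel s x p -> above_rel t y p ->
  s <= t -> forall z, above_rel t y z -> above_rel s x z.
Proof.
move=> [u [su ux up]] [v [tv vy vp]] st z [w [tw wy wz]].
have [m [tm mp mz]] : exists m, [/\ t < m, m <= p & m <= z].
  have [vw|wv] := below_total hX vy wy; first by exists v; split=> //; exact: le_trans wz.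
  by exists w; split=> //; exact: le_trans vp.
have [um|mu] := below_total hX up mp; first by exists u; split=> //; exact: le_trans mz.
by exists m; split=> //; [exact: le_lt_trans tm|exact: le_trans ux].
Qed.

Section Family.
Variable s : X -> X.
Let cone x := [set z | above_rel (s x) x z].
(** Exactly the points whose cone is non-empty. *)
Let J := [set x | s x < x].

Lemma cone_self x : J x -> cone x x.
Proof. by move=> sx; exists x. Qed.

Lemma cone_meet x y p : J x -> J y -> cone x p -> cone y p -> cone x y \/ cone y x.
Proof.
move=> Jx Jy xp yp; have [xy|yx] := cone_total xp yp.
  by left; apply: (cone_nested xp yp xy); exact: cone_self.
by right; apply: (cone_nested yp xp yx); exact: cone_self.
Qed.

Hypothesis countable_cones : forall z, countable [set x | cone x z].

(* The roots [s x] of a chain of cones are linearly ordered, hence have a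
   countable cofinal subset. *)
Lemma countable_cone_chain (C : set X) : C `<=` J ->
  (forall x y, C x -> C y -> [\/ x = y, cone x y | cone y x]) -> countable C.
Proof.
move=> CJ Cc.
have [|W [WC cW Wcof]] := chain_cofinal hX (C := s @` C).
  move=> _ _ [x Cx <-] [y Cy <-].
  have [->|xy|yx] := Cc _ _ Cx Cy; first by left.
    exact: cone_total xy (cone_self (CJ _ Cy)).
  exact: cone_total (cone_self (CJ _ Cx)) yx.
have /choice[g gP] : forall l, exists x, W l -> C x /\ s x = l.
  move=> l; have [/WC[x Cx xl]|nW] := pselect (W l); first by exists x.
  by exists \bot.
apply: (@countable_sub _ _ (\bigcup_(l in W) [set x | cone x (g l)])).
  move=> x Cx; have [|l Wl sxl] := Wcof (s x); first by exists x.
  exists l => //=; have [Cg sg] := gP _ Wl.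
  have [->|//|[w [gw wg wx]]] := Cc _ _ Cx Cg; first exact/cone_self/CJ.
  by exists w; split=> //; rewrite (le_lt_trans sxl) // -sg.
by apply: bigcup_countable.
Qed.

(** The meet of two incomparable points of the cone lies in the cone and has them in different
    components, so it is branching. *)
Lemma cone_linear x : (forall z, cone x z -> ~ branching z) ->
  forall u v, cone x u -> cone x v -> u <= v \/ v <= u.
Proof.
move=> nb u v [u' [su ux uu]] [v' [sv vx vv]]; apply: contrapT => nuv.
have [m [mu mv mglb]] := meet_exists hX u v.
have mcone : cone x m.
  have [uv|vu] := below_total hX ux vx.
    by exists u'; split=> //; apply: mglb => //; exact: le_trans vv.
  by exists v'; split=> //; apply: mglb => //; exact: le_trans uu.
have ltmu : m < u.
  by rewrite lt_neqAle mu andbT; apply/eqP => mE; apply: nuv; left; rewrite -mE.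
have ltmv : m < v.
  by rewrite lt_neqAle mv andbT; apply/eqP => mE; apply: nuv; right; rewrite -mE.
apply: (nb m mcone).
exists [set z | m < z /\ above_rel m u z], [set z | m < z /\ above_rel m v z].
split; [by exists u|by exists v|].
move=> /(congr1 (@^~ v)) E; have : m < v /\ above_rel m u v.
  by move: E => /= ->; split=> //; exists v.
by move=> [_ [w [mw wu wv]]]; have := mglb w wu wv; rewrite (lt_geF mw).
Qed.

Lemma cone_colouring (K : Type) : martin_axiom K ->
  [set x : X | branching x] #<= [set: K] ->
  exists F : X -> nat, forall x y p, J x -> J y -> cone x p -> cone y p ->
    x <> y -> F x <> F y.
Proof.
move=> MA hK.
pose B := [set x : X | branching x].
have /choice[i iinj] : forall z, exists i : X -> nat,
    {in [set x | cone x z] &, injective i}.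
  by move=> z; apply/countable_injP.
pose J1 := [set x | J x /\ exists2 b, B b & cone x b].
have J1J : J1 `<=` J by move=> x [].
pose r x y := x <> y /\ cone x y.
have rE x y : J x -> J y -> cone x y \/ cone y x -> x = y \/ r x y \/ r y x.
  move=> Jx Jy xy; have [->|/eqP nxy] := eqVneq x y; first by left.
  by right; case: xy => xy; [left|right]; split=> // /esym.
have [F1 F1P] : exists F : X -> nat, forall x y, J1 x -> J1 y -> r x y -> F x <> F y.
  (* For finite [K] the bound by [K] may fail, but then [J1] is countable and an injective colouring
     suffices. *)
  have [finK|infK] := pselect (finite_set [set: K]).
    have /countable_injP[F Finj] : countable J1.
      apply: (@countable_sub _ _ (\bigcup_(b in B) [set x | cone x b])).
        by move=> x [_ [b Bb xb]]; exists b.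
      apply: bigcup_countable => //; apply: finite_set_countable.
      exact: card_le_finite hK finK.
    by exists F => x y Jx Jy [xy _] Fxy; apply: xy; apply: Finj; rewrite ?inE.
  apply: (@martin_colouring _ J1 r _ _ _ K MA).
  - by move=> x [].
  - move=> x y z /J1J Jx /J1J Jy _ [_ xz] [_ yz]; apply: rE => //.
    exact: cone_meet xz yz.
  - move=> C CJ Cc; apply: countable_cone_chain => [x /CJ/J1J //|x y Cx Cy].
    by have [->|[[_]|[_]]] := Cc _ _ Cx Cy; [exact: Or31|exact: Or32|exact: Or33].
  (* A point of [J1] is determined by a branching node in its cone and its number among the
     countably many points whose cones contain that node. *)
  apply: card_le_trans (card_mul_nat infK).
  elim/Ppointed: K hK {MA infK} => K hK.
    apply: (@card_le_trans _ _ _ (@set0 X)); last exact: card_ge0.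
    apply: subset_card_le => x [_ [b Bb _]].
    have : B = set0 by apply/eqP; move: hK; rewrite emptyE.
    by move=> B0; rewrite B0 in Bb.
  have /pcard_injP[k kinj] := hK.
  have /choice[b bP] : forall x, exists b, J1 x -> B b /\ cone x b.
    move=> x; have [[_ [b Bb xb]]|nJ] := pselect (J1 x); first by exists b.
    by exists x.
  apply: (@inj_on_card_le _ _ _ _ (fun x => (k (b x), i (b x) x))) => //.
  move=> x y /set_mem J1x /set_mem J1y [kb ib].
  have [Bx xb] := bP _ J1x; have [By yb] := bP _ J1y.
  have bE : b x = b y by apply: kinj; rewrite ?inE.
  by rewrite -bE in yb ib; apply: (iinj (b x)) ib; exact: mem_set.
pose J2 := [set x | J x /\ ~ exists2 b, B b & cone x b].
(* Overlapping is transitive on [J2] because these cones are linear. Hence [cl x] is an equivalence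
   class, and its cones form a chain, so it is countable. *)
pose cl x := [set y | J2 y /\ exists2 p, cone x p & cone y p].
have lin x : J2 x -> forall u v, cone x u -> cone x v -> u <= v \/ v <= u.
  by move=> [_ nb]; apply: cone_linear => z xz Bz; apply: nb; exists z.
have trans x y z : J2 y -> (exists2 p, cone x p & cone y p) ->
    (exists2 p, cone y p & cone z p) -> exists2 p, cone x p & cone z p.
  move=> J2y [p xp yp] [q yq zq]; have [pq|qp] := lin _ J2y _ _ yp yq.
    by exists q => //; exact: above_rel_up pq.
  by exists p => //; exact: above_rel_up qp.
have sym x y : (exists2 p, cone x p & cone y p) -> exists2 p, cone y p & cone x p.
  by move=> [p]; exists p.
have ccl x : J2 x -> countable (cl x).
  move=> J2x; apply: countable_cone_chain => [y [[]]//|y z [J2y xy] [J2z xz]].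
  have [p yp zp] := trans _ _ _ J2x (sym _ _ xy) xz.
  by have [yz|zy] := cone_meet J2y.1 J2z.1 yp zp; [exact: Or32|exact: Or33].
have /choice[c cP] : forall C : set X, exists c : X -> nat,
    countable C -> {in C &, injective c}.
  move=> C; have [/countable_injP[c cinj]|nC] := pselect (countable C).
    by exists c.
  by exists (fun=> 0%N).
have clE x y p : J2 x -> J2 y -> cone x p -> cone y p -> cl x = cl y.
  move=> J2x J2y xp yp; have xy : exists2 p, cone x p & cone y p by exists p.
  apply/seteqP; split=> z [J2z hz]; split=> //.
    exact: trans J2x (sym _ _ xy) hz.
  exact: trans J2y xy hz.
(* Even colours go to [J1] and odd ones to the rest, so that mixed pairs never clash. *)
exists (fun x => if `[< J1 x >] then (F1 x).*2 else (c (cl x) x).*2.+1).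
move=> x y p Jx Jy xp yp xy.
case: asboolP => J1x; case: asboolP => J1y.
- move=> /double_inj; have [/eqP//|[rxy|ryx]] := rE _ _ Jx Jy (cone_meet Jx Jy xp yp).
    exact: F1P.
  by move=> /esym; exact: F1P.
- by move=> /(congr1 odd); rewrite /= !odd_double.
- by move=> /(congr1 odd); rewrite /= !odd_double.
have J2x : J2 x by split=> // bx; apply: J1x.
have J2y : J2 y by split=> // bx; apply: J1y.
rewrite -(clE _ _ _ J2x J2y xp yp) => -[/double_inj cxy]; apply: xy.
apply: (cP (cl x) (ccl _ J2x)) cxy; rewrite inE; split=> //.
  by exists x; exact: cone_self.
by exists p.
Qed.

End Family.

Lemma cones_exist : exists s : X -> X, [/\ forall x, s x <= x,
  forall z, countable [set x | above_rel (s x) x z] &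
  forall u v, u < v -> exists x w, [/\ u < w, w <= v, w <= x & s x < w]].
Proof.
have [prec [wf tot]] := well_order_exists X.
pose Y x := [set z | z <= x /\ exists2 y, prec y x & z <= y].
have /choice[s sP] : forall x, exists s, [/\ s <= x, forall a, Y x a -> a <= s &
    forall w, w < s -> exists2 a, Y x a & w < a].
  by move=> x; apply: (sup_below hX) => a [].
exists s; split.
- by move=> x; case: (sP x).
- suff H x : forall z, z <= x -> countable [set x | above_rel (s x) x z].
    by move=> z; exact: (H z z (lexx z)).
  elim: x / (wf x) => x _ IH z zx.
  pose S := [set v | v <= z /\ exists2 y, prec y x & v <= y].
  have [|W [WS cW Wcof]] := chain_cofinal hX (C := S).
    by move=> a b [az _] [bz _]; have := below_total hX az bz.
  apply: (@countable_sub _ _ ([set x] `|`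
    \bigcup_(w in W) [set x | above_rel (s x) x w])).
    (* The cone of an earlier [x'] contains a point of [S], hence some [w] in [W], where induction
       applies. For a later [x'], the point [v] is already covered by [x], which forces
       [v <= s x']. *)
    move=> x' [v [sv vx' vz]]; have [->|xx'|x'x] := tot x' x; first by left.
      right; have [|w Ww vw] := Wcof v; first by split=> //; exists x'.
      by exists w => //; exists v.
    have [_ /(_ v) + _] := sP x'; rewrite (lt_geF sv) => sP'.
    suff : false by [].
    by apply: sP'; split=> //; exists x => //; exact: le_trans zx.
  apply: countableU; first exact: countable1.
  apply: bigcup_countable => // w /WS[_ [y yx wy]]; exact: IH yx _ wy.
- move=> u v uv; suff H x : forall v, u < v -> v <= x ->
      exists x w, [/\ u < w, w <= v, w <= x & s x < w].
    exact: (H v v uv (lexx v)).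
  elim: x / (wf x) => x _ IH {}v {}uv vx; have [sx sY sY'] := sP x.
  (* If [v] is not below [s x], then [x] itself serves. Otherwise some [a] above [u] lies below an
     earlier [y], and induction applies to the smaller of [a] and [v]. *)
  have [vs|nvs] := boolP (v <= s x); last first.
    exists x, v; split=> //; have [vs|sv] := below_total hX vx sx.
      by rewrite vs in nvs.
    by rewrite lt_neqAle sv andbT; apply: contraNneq nvs => ->.
  have [a [ax [y yx ay]] ua] := sY' u (lt_le_trans uv vs).
  have [av|va] := below_total hX ax vx; last exact: IH yx _ uv (le_trans va ay).
  have [x' [w [uw wa wx' sw]]] := IH y yx a ua ay.
  by exists x', w; split=> //; exact: le_trans av.
Qed.

End Cones.

(** * Gluing the bumps of each colour *)

Theorem theorem5p14 (R : realType) (K : Type) (MA : martin_axiom K)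
    (d : Order.disp_t) (X : bPOrderType d) (hX : branchwise_real R X)
    (hK : [set x : X | branching x] #<= [set: K]) :
  continuously_gradable R X.
Proof.
have [s [sx scount ssep]] := cones_exist hX.
have /choice[f fP] := fun x => bump_exists hX (sx x).
have [F FP] := cone_colouring hX scount MA hK.
have conflict x y p : s x < x -> s y < y -> 0 < f x p -> 0 < f y p ->
    F x = F y -> x = y.
  move=> Jx Jy xp yp Fxy; have [_ _ _ fpos _] := fP x.
  have [_ _ _ gpos _] := fP y; apply: contrapT => xy.
  by apply: (FP x y p) xy Fxy => //; [exact/fpos|exact/gpos].
pose level n y x := [/\ s x < x, F x = n & 0 < f x y].
(* Below [y], [psi n] is the bump of colour [n] positive at [y], unique by [conflict], or zero if
   there is none. *)
have /choice[psi psiP] : forall n, exists psi : X -> R,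
    (forall x y z, level n y x -> z <= y -> psi z = f x z) /\
    (forall y z, ~ (exists x, level n y x) -> z <= y -> psi z = 0).
  move=> n; have /choice[psi psiP] : forall z, exists t : R,
      (forall x, level n z x -> t = f x z) /\
      (~ (exists x, level n z x) -> t = 0).
    move=> z; have [[x xz]|nx] := pselect (exists x, level n z x).
      exists (f x z); split=> [y [Jy Fy yz]|[]]; last by exists x.
      by case: xz => Jx Fx xz; rewrite (conflict _ _ _ Jx Jy xz yz) // Fx.
    by exists 0; split=> // x xz; case: nx; exists x.
  have up y z x : z <= y -> level n z x -> level n y x.
    move=> zy [Jx Fx xz]; split=> //; apply: lt_le_trans xz _.
    by have [_ fhomo _ _ _] := fP x; exact: fhomo.
  exists psi; split=> [x y z xy zy|y z ny zy]; have [p0 p1] := psiP z.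
    have [/p0//|nxz] := pselect (level n z x).
    have [f0 _ _ _ _] := fP x; rewrite p1.
      have [Jx Fx _] := xy; apply/le_anti; have /andP[-> _] := f0 z.
      by rewrite leNgt; apply/negP => xz; exact: nxz.
    move=> [x' x'z]; apply: nxz; have [Jx' Fx' x'y] := up _ _ _ zy x'z.
    have [Jx Fx fxy] := xy.
    by rewrite (conflict _ _ _ Jx Jx' fxy x'y) // Fx.
  by apply: p1 => -[x xz]; apply: ny; exists x; exact: up xz.
(* Monotonicity and the absence of jumps can be checked on one segment at a time, where [psi n] is a
   single bump or zero. *)
have local n y : (exists x, forall z, z <= y -> psi n z = f x z) \/
    (forall z, z <= y -> psi n z = 0).
  have [pf p0] := psiP n; have [[x xy]|ny] := pselect (exists x, level n y x).
    by left; exists x => z; exact: pf.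
  by right=> z; exact: p0.
apply: (series_gradable hX (psi := psi)).
- move=> n z; have [[x ->//]|->//] := local n z; last by rewrite lexx ler01.
  by have [f0 _ _ _ _] := fP x; exact: f0.
- move=> n y z yz; have [[x xz]|z0] := local n z; last by rewrite !z0.
  by rewrite !xz //; have [_ fhomo _ _ _] := fP x; exact: fhomo.
- move=> n e e0; split=> [z z0|z y zy].
    have [[x xz]|xz] := local n z; last first.
      by exists \bot => //; rewrite !xz ?le0x // add0r.
    have [_ _ /(_ e e0)[/(_ z z0)[w wz fw] _] _ _] := fP x.
    by exists w => //; rewrite !xz // ltW.
  have [[x xy]|xy] := local n y; last first.
    by exists y; split=> //; rewrite !xy ?(ltW zy) // add0r.
  have [_ _ /(_ e e0)[_ /(_ z y zy)[w [zw wy fw]]] _ _] := fP x.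
  by exists w; split=> //; rewrite !xy // ltW.
(* The bump of [x] increases strictly from [u] to [w], and below [v] it is the one that [psi (F x)]
   follows. *)
- move=> u v uv; have [x [w [uw wv wx sw]]] := ssep u v uv.
  have [f0 fhomo _ _ fstr] := fP x; have fuw := fstr u w uw wx sw.
  have fuv : f x u < f x v := lt_le_trans fuw (fhomo _ _ wv).
  exists (F x); have lev : level (F x) v x.
    split=> //; first exact: lt_le_trans sw wx.
    by apply: le_lt_trans fuv; case/andP: (f0 u).
  have [pf _] := psiP (F x).
  by rewrite (pf _ _ _ lev (ltW uv)) (pf _ _ _ lev (lexx v)).
Qed.
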